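(* Let $F$ be any field, let $G$ be a finite group, and let $n,m,p$ be positive integers. If $G$ realizes $\langle n,m,p\rangle$, then the number of field operations required to multiply $n\times m$ matrices with $m\times p$ matrices over $F$ is at most the number of field operations required to multiply two elements of the group algebra $F[G]$. Furthermore, $\langle n,m,p\rangle_F \le F[G]$, where $\le$ is the restriction relation.
   Context: For a subset $S$ of a group, $Q(S)=\{s_1s_2^{-1}: s_1,s_2\in S\}$. A group $G$ realizes $\langle n_1,n_2,n_3\rangle$ if there are subsets $S_1,S_2,S_3\subseteq G$ with $|S_i|=n_i$ such that for all $q_i\in Q(S_i)$, if $q_1q_2q_3=1$ then $q_1=q_2=q_3=1$. $\langle n,m,p\rangle_F$ denotes the structural tensor (equivalently, the bilinear map $F^{n\times m}\times F^{m\times p}\to F^{n\times p}$, $(A,B)\mapsto AB$) of matrix multiplication over $F$. In the relation $\langle n,m,p\rangle_F\le F[G]$, $F[G]$ stands for the structural tensor (equivalently, the bilinear multiplication map $F[G]\times F[G]\to F[G]$) of the group algebra. Restriction: for bilinear maps $\varphi:U\times V\to W$ and $\psi:U'\times V'\to W'$ of finite-dimensional $F$-vector spaces, $\varphi\le\psi$ means that there are $F$-linear maps $a:U\to U'$, $b:V\to V'$, $c:W'\to W$ with $\varphi(u,v)=c(\psi(a(u),b(v)))$ for all $u\in U$, $v\in V$. The number of field operations is the minimal number of arithmetic operations in $F$ of an algebraic (arithmetic circuit / straight-line) computation that takes as input the entries of the two matrices (respectively the coefficients, with respect to the basis $G$, of the two group algebra elements) and outputs the entries of the product (respectively the coefficients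 of the product); constants of $F$ are available for free. *)

(* Defs.v *)
From HB Require Import structures.
From mathcomp Require Import all_boot all_order all_fingroup all_algebra.

Set Implicit Arguments.
Unset Strict Implicit.
Unset Printing Implicit Defensive.

Import GRing.Theory.
Local Open Scope ring_scope.

Section Realizes.

Variable gT : finGroupType.

Definition Qset (S : {set gT}) : {set gT} :=
  [set (s1 * s2^-1)%g | s1 in S, s2 in S].

Definition realizes (n1 n2 n3 : nat) : Prop :=
  exists S1 S2 S3 : {set gT},
    [/\ #|S1| = n1, #|S2| = n2, #|S3| = n3 &
      forall q1 q2 q3 : gT,
        q1 \in Qset S1 -> q2 \in Qset S2 -> q3 \in Qset S3 ->
        (q1 * q2 * q3)%g = 1%g -> [/\ q1 = 1%g, q2 = 1%g & q3 = 1%g]].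

End Realizes.

Section GroupAlgebra.

Variables (F : fieldType) (gT : finGroupType).

(* F^o (convertible to F) is what gives the finite functions their F-vector
   space structure; the value of a at g is the coefficient of g in a. *)
Definition group_algebra := {ffun gT -> F^o}.

Definition galg_mul (a b : group_algebra) : group_algebra :=
  [ffun g => \sum_(h : gT) \sum_(k : gT | (h * k)%g == g) (a h : F) * (b k : F)].

Lemma galg_mul_is_bilinear :
  bilinear_for
    (GRing.Scale.Law.clone _ _ *:%R _) (GRing.Scale.Law.clone _ _ *:%R _)
    galg_mul.
Proof.
split=> [b|a] c u v; apply/ffunP=> g; rewrite !ffunE scaler_sumr -big_split /=;
  apply: eq_bigr => h _; rewrite scaler_sumr -big_split /=;
  apply: eq_bigr => k _; rewrite !ffunE.
  by rewrite mulrDl /GRing.scale /= mulrA.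
by rewrite mulrDr /GRing.scale /= mulrCA.
Qed.

HB.instance Definition _ :=
  bilinear_isBilinear.Build F group_algebra group_algebra group_algebra
    (GRing.Scale.Law.clone _ _ *:%R _) (GRing.Scale.Law.clone _ _ *:%R _)
    galg_mul galg_mul_is_bilinear.

End GroupAlgebra.

Section Restriction.

Variables (F : fieldType) (U V W U' V' W' : vectType F).

Definition restricts (phi : {bilinear U -> V -> W})
    (psi : {bilinear U' -> V' -> W'}) : Prop :=
  exists (a : 'Hom(U, U')) (b : 'Hom(V, V')) (c : 'Hom(W', W)),
    forall u v, phi u v = c (psi (a u) (b v)).

End Restriction.

Definition mxmul_bilinear (F : fieldType) (n m p : nat) :
    {bilinear 'M[F]_(n, m) -> 'M[F]_(m, p) -> 'M[F]_(n, p)} :=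
  @mulmx F n m p.

Definition galg_bilinear (F : fieldType) (gT : finGroupType) :
    {bilinear group_algebra F gT -> group_algebra F gT -> group_algebra F gT} :=
  @galg_mul F gT.

Variant field_op := OpAdd | OpSub | OpMul | OpDiv.

Section StraightLine.

Variables (F : fieldType) (I O : Type).

(* [Result j] is the value computed by the j-th instruction, from 0. *)
Variant operand := Const of F | Input of I | Result of nat.

Record instr := Instr { op : field_op; lhs : operand; rhs : operand }.

Record slp := SLP { instrs : seq instr; outputs : O -> operand }.

(* Only the field operations are counted: constants, inputs and the selection
   of the outputs are free. *)
Definition cost (P : slp) : nat := size (instrs P).

Definition operand_value (x : I -> F) (r : seq F) (a : operand) : option F :=
  match a with
  | Const c => Some c
  | Input i => Some (x i)
  | Result j => onth r j
  end.

(* [None] is failure: a division by zero, or below a reference to an instruction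
   that has not been executed yet. *)
Definition apply_op (o : field_op) (u v : F) : option F :=
  match o with
  | OpAdd => Some (u + v)
  | OpSub => Some (u - v)
  | OpMul => Some (u * v)
  | OpDiv => if v == 0 then None else Some (u / v)
  end.

Definition exec (x : I -> F) (r : seq F) (i : instr) : option F :=
  match operand_value x r (lhs i), operand_value x r (rhs i) with
  | Some u, Some v => apply_op (op i) u v
  | _, _ => None
  end.

Fixpoint run (x : I -> F) (r : seq F) (s : seq instr) : option (seq F) :=
  match s with
  | [::] => Some r
  | i :: s' => if exec x r i is Some v then run x (rcons r v) s' else None
  end.

(* The computation must succeed on every input in F. *)
Definition computes (P : slp) (f : (I -> F) -> O -> F) : Prop :=
  forall x : I -> F, exists2 r : seq F,
    run x [::] (instrs P) = Some r &
    forall o : O, operand_value x r (outputs P o) = Some (f x o).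

Definition is_num_ops (f : (I -> F) -> O -> F) (k : nat) : Prop :=
  (exists2 P : slp, computes P f & cost P = k) /\
  (forall P : slp, computes P f -> (k <= cost P)%N).

End StraightLine.

Definition mxmul_coords (F : fieldType) (n m p : nat)
    (x : 'I_n * 'I_m + 'I_m * 'I_p -> F) (o : 'I_n * 'I_p) : F :=
  (\matrix_(i < n, j < m) x (inl (i, j)) *m
   \matrix_(j < m, k < p) x (inr (j, k))) o.1 o.2.

Definition galg_mul_coords (F : fieldType) (gT : finGroupType)
    (x : gT + gT -> F) (g : gT) : F :=
  galg_mul [ffun h => x (inl h) : F^o] [ffun h => x (inr h) : F^o] g.

(* Main.v *)
Require Import Defs.
From HB Require Import structures.
From mathcomp Require Import all_boot all_order all_fingroup all_algebra.
From Stdlib Require Import Classical.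

(** Index the three subsets by injections [s], [t], [u].  The matrix [A] is sent
    to the sum of the [A i j (s i)^-1 (t j)] and [B] to the sum of the
    [B j k (t j)^-1 (u k)]; the triple product property says that in the product
    of these group algebra elements the coefficient of [(s i)^-1 (u k)] collects
    exactly the terms [A i j * B j k].  Each coefficient of the two elements is
    an entry of a matrix or [0], so renaming the inputs and selecting outputs
    turns an optimal computation of the group algebra product into one of the
    matrix product with the same operations. *)

Set Implicit Arguments.
Unset Strict Implicit.
Unset Printing Implicit Defensive.

Import GRing.Theory.
Local Open Scope ring_scope.

(** Whether some program of length [n] computes a given function need not be decidable over an
    arbitrary field, so the least cost is obtained by excluded middle. *)
Lemma classical_ex_minn (P : nat -> Prop) :
  (exists n, P n) -> exists2 n, P n & forall m, P m -> (n <= m)%N.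
Proof.
case=> n; have [k] := ubnP n; elim: k n => // k IHk n /ltnSE le_nk Pn.
have [[m Pm lt_mn] | minn] := classic (exists2 m, P m & (m < n)%N).
  exact: IHk m (leq_trans lt_mn le_nk) Pm.
by exists n => // m Pm; rewrite leqNgt; apply/negP => lt_mn; case: minn; exists m.
Qed.

Section StraightLineTheory.

Variable F : fieldType.

(** * Existence of straight-line programs *)

Section Availability.

Variables (I : Type).
Implicit Types (x : I -> F) (r : seq F) (s : seq (instr F I)).
Implicit Types (f g : (I -> F) -> F).

Definition total s := forall x, exists r, run x [::] s = Some r.

(** The operand is chosen before the input [x]: one place of the program must hold the value of [f]
    on all inputs. *)
Definition available s f := exists a, forall x r,
  run x [::] s = Some r -> operand_value x r a = Some (f x).

Lemma run_cat x r s s' :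
  run x r (s ++ s') = obind (run x ^~ s') (run x r s).
Proof. by elim: s r => //= i s IHs r; case: (exec x r i). Qed.

Lemma operand_value_cat x r r' (a : operand F I) v :
  operand_value x r a = Some v -> operand_value x (r ++ r') a = Some v.
Proof.
case: a => //= j; elim: r j => [|y r IHr] [|j] //=; exact: IHr.
Qed.

Lemma run_extends x r s r' : run x r s = Some r' -> exists r1, r' = r ++ r1.
Proof.
elim: s r => [|i s IHs] r /=; first by case=> <-; exists [::]; rewrite cats0.
case: (exec x r i) => // v /IHs[r1 ->]; exists (v :: r1).
by rewrite cat_rcons.
Qed.

Lemma size_run x r s r' : run x r s = Some r' -> size r' = (size r + size s)%N.
Proof.
elim: s r => [|i s IHs] r /=; first by case=> <-; rewrite addn0.
by case: (exec x r i) => // v /IHs ->; rewrite size_rcons addSnnS.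
Qed.

Lemma available_cat s s' f : available s f -> available (s ++ s') f.
Proof.
case=> a av; exists a => x r; rewrite run_cat.
case Dr0: (run x [::] s) => [r0|] //= /run_extends[r1 ->].
exact: operand_value_cat (av _ _ Dr0).
Qed.

(** Quantifying over every total prefix [s] makes the notion compositional: code for several
    functions is appended in turn, and earlier results keep their indices. *)
Definition computable f :=
  forall s, total s -> exists s', total (s ++ s') /\ available (s ++ s') f.

Lemma eq_computable f g : f =1 g -> computable f -> computable g.
Proof.
move=> fg cf s /cf[s' [tot [a av]]]; exists s'; split=> //.
by exists a => x r /av ->; rewrite fg.
Qed.

Lemma computable_operand (a : operand F I) f :
  (forall x r, operand_value x r a = Some (f x)) -> computable f.
Proof. by move=> av s tot; exists [::]; rewrite cats0; split=> //; exists a. Qed.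

Lemma computable_op (o : field_op) f g h :
    (forall x, apply_op o (f x) (g x) = Some (h x)) ->
  computable f -> computable g -> computable h.
Proof.
move=> fgh cf cg s /cf[s1 [/cg[s2 [tot [b bv]]] /(@available_cat _ s2)[a av]]].
pose s3 := (s ++ s1) ++ s2.
have run3 x r : run x [::] s3 = Some r ->
    run x [::] (rcons s3 (Instr o a b)) = Some (rcons r (h x)).
  by move=> Dr; rewrite -cats1 run_cat Dr /= /exec /= (av _ _ Dr) (bv _ _ Dr) fgh.
exists (s1 ++ rcons s2 (Instr o a b)); rewrite catA -rcons_cat -/s3; split=> [x|].
  by have [r /run3 Dr] := tot x; exists (rcons r (h x)).
(* Results are numbered from 0, so the instruction after the [size s3] instructions of [s3] has
   index [size s3]. *)
exists (Result F I (size s3)) => x r' /=.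
have [r Dr] := tot x; rewrite (run3 _ _ Dr) => -[<-].
by have /= := size_run Dr; rewrite add0n => <-; rewrite -cats1 onth_cat ltnn subnn.
Qed.

Lemma computable_const c : computable (fun=> c).
Proof. exact: (@computable_operand (Const I c)). Qed.

Lemma computable_input i : computable (fun x => x i).
Proof. exact: (@computable_operand (Input F i)). Qed.

Lemma computable_mul f g :
  computable f -> computable g -> computable (fun x => f x * g x).
Proof. exact: (@computable_op OpMul). Qed.

Lemma computable_sum (J : Type) (js : seq J) (P : pred J) (f : J -> (I -> F) -> F) :
    (forall j, P j -> computable (f j)) ->
  computable (fun x => \sum_(j <- js | P j) f j x).
Proof.
move=> cf; elim: js => [|j js IHjs].
  by apply: eq_computable (computable_const 0) => x; rewrite big_nil.
case Pj: (P j); last by apply: eq_computable IHjs => x; rewrite big_cons Pj.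
apply: (computable_op (o := OpAdd)) (cf j Pj) IHjs => x.
by rewrite big_cons Pj.
Qed.

(** Code for the outputs is appended one output at a time. Finiteness of [O] then lets the operands
    be gathered into a function without a choice axiom. *)
Lemma computes_exists (O : finType) (f : (I -> F) -> O -> F) :
  (forall o, computable (f^~ o)) -> exists P : slp F I O, computes P f.
Proof.
move=> cf.
suffices [s tot av] :
    exists2 s, total s & forall o, o \in enum O -> available s (f^~ o).
  have /fin_all_exists[out outP] o : available s (f^~ o) by apply: av; rewrite mem_enum.
  exists (SLP s out) => x; have [r Dr] := tot x; exists r => // o.
  exact: outP Dr.
elim: (enum O) => [|o os [s tot av]]; first by exists [::] => // x; exists [::].
have [s' [tot' av']] := cf o s tot; exists (s ++ s') => // o1.
by rewrite inE => /predU1P[->//|/av/available_cat].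
Qed.

End Availability.

(** * Renaming inputs, and minimal costs *)

Section Substitution.

Variables (I I' O O' : Type) (sigma : I -> F + I') (tau : O' -> O).

Definition subst_input (x : I' -> F) (i : I) : F :=
  match sigma i with inl c => c | inr i' => x i' end.

Definition subst_operand (a : operand F I) : operand F I' :=
  match a with
  | Const c => Const I' c
  | Input i => match sigma i with inl c => Const I' c | inr i' => Input F i' end
  | Result j => Result F I' j
  end.

Definition subst_instr (i : instr F I) : instr F I' :=
  Instr (op i) (subst_operand (lhs i)) (subst_operand (rhs i)).

(** Inputs become constants or other inputs, and outputs are reselected along [tau]; all of this is
    free, so the instructions correspond one to one. *)
Definition subst_slp (P : slp F I O) : slp F I' O' :=
  SLP (map subst_instr (instrs P)) (fun o => subst_operand (outputs P (tau o))).

Lemma subst_operand_value x r a :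
  operand_value x r (subst_operand a) = operand_value (subst_input x) r a.
Proof. by case: a => //= i; rewrite /subst_input; case: (sigma i). Qed.

Lemma run_subst x r s :
  run x r (map subst_instr s) = run (subst_input x) r s.
Proof.
elim: s r => //= i s IHs r; rewrite /exec /= !subst_operand_value.
by case: (operand_value _ _ (lhs i)) (operand_value _ _ (rhs i)) => [u|] [v|] //;
  case: (apply_op _ u v).
Qed.

Lemma computes_subst (P : slp F I O) f :
  computes P f ->
  computes (subst_slp P) (fun x o => f (subst_input x) (tau o)).
Proof.
move=> Pf x; have [r Dr out] := Pf (subst_input x).
by exists r => [|o]; rewrite ?run_subst //= subst_operand_value.
Qed.

Lemma cost_subst (P : slp F I O) : cost (subst_slp P) = cost P.
Proof. exact: size_map. Qed.

End Substitution.

Lemma eq_computes (I O : Type) (P : slp F I O) f g :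
  (forall x, f x =1 g x) -> computes P f -> computes P g.
Proof.
by move=> fg Pf x; have [r ? out] := Pf x; exists r => // o; rewrite out fg.
Qed.

Lemma num_ops_exists (I O : Type) (P : slp F I O) f :
  computes P f -> exists2 k, is_num_ops f k & (k <= cost P)%N.
Proof.
move=> Pf; have [|k [Q Qf DQ] mink] :=
  @classical_ex_minn (fun k => exists2 Q : slp F I O, computes Q f & cost Q = k).
  by exists (cost P), P.
by exists k; [split=> [|Q' Q'f]; [exists Q|apply: mink; exists Q']|apply: mink; exists P].
Qed.

End StraightLineTheory.

(** * The group algebra product and the triple product property *)

Section GroupAlgebraTheory.

Variables (F : fieldType) (gT : finGroupType).

Lemma galg_mul_coords_computable g :
  computable (@galg_mul_coords F gT ^~ g).
Proof.
apply: (@eq_computable _ _ (fun x =>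
  \sum_h \sum_(k | (h * k)%g == g) x (inl h) * x (inr k))).
  by move=> x; rewrite /galg_mul_coords ffunE; do 2![apply: eq_bigr => ? _];
     rewrite !ffunE.
do 2!apply: computable_sum => ? _.
by apply: computable_mul; apply: computable_input.
Qed.

Lemma galg_mulE (a b : group_algebra F gT) g :
  galg_mul a b g = \sum_h (a h : F) * b (h^-1 * g)%g.
Proof.
rewrite ffunE; apply: eq_bigr => h _.
by rewrite (big_pred1 (h^-1 * g)%g) // => k /=; rewrite (can2_eq (mulKg h) (mulKVg h)).
Qed.

End GroupAlgebraTheory.

(** Concluding on indices rather than on quotients builds in injectivity: equal values of [s] force
    equal indices once some [j] and [k] are available to fill the other two quotients with 1. *)
Definition triple_product (gT : finGroupType) (n m p : nat)
    (s : 'I_n -> gT) (t : 'I_m -> gT) (u : 'I_p -> gT) :=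
  forall i i' j j' k k',
    (s i * (s i')^-1 * (t j * (t j')^-1) * (u k * (u k')^-1) = 1)%g ->
  [/\ i = i', j = j' & k = k'].

Lemma realizes_triple_product (gT : finGroupType) (n m p : nat) :
    realizes gT n m p ->
  exists (s : 'I_n -> gT) (t : 'I_m -> gT) (u : 'I_p -> gT), triple_product s t u.
Proof.
case=> S1 [S2 [S3 [<- <- <- tpp]]]; exists enum_val, enum_val, enum_val.
move=> i i' j j' k k' /tpp[].
1-3: by apply: imset2_f; apply: enum_valP.
move=> /(canRL (mulgKV _)) + /(canRL (mulgKV _)) + /(canRL (mulgKV _)).
by rewrite !mul1g => /enum_val_inj-> /enum_val_inj-> /enum_val_inj->.
Qed.

(** * Matrices inside the group algebra *)

Section Embedding.

Variables (F : fieldType) (gT : finGroupType).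

Section Pair.

Variables (n m : nat) (s : 'I_n -> gT) (t : 'I_m -> gT).

(** A partial inverse of the map from pairs to group elements when that map is injective. It serves
    both the coefficients of the embedding and the renaming of program inputs. *)
Definition entry_index (g : gT) : option ('I_n * 'I_m) :=
  [pick ij | ((s ij.1)^-1 * t ij.2)%g == g].

Definition entry_coef (A : 'M[F]_(n, m)) (g : gT) : F :=
  if entry_index g is Some ij then A ij.1 ij.2 else 0.

Section Injective.

Hypothesis st_inj : injective (fun ij : 'I_n * 'I_m => (s ij.1)^-1 * t ij.2)%g.

Lemma entry_coef_val A ij : entry_coef A ((s ij.1)^-1 * t ij.2)%g = A ij.1 ij.2.
Proof.
rewrite /entry_coef /entry_index; case: pickP => [ij' /eqP/st_inj-> //|].
by move/(_ ij); rewrite eqxx.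
Qed.

(** Pairs are grouped by the group element they give: by injectivity each fibre is a single pair or
    empty, and over an empty one the coefficient is 0. *)
Lemma sum_entry_coef A (f : gT -> F) :
  \sum_g entry_coef A g * f g = \sum_i \sum_j A i j * f ((s i)^-1 * t j)%g.
Proof.
rewrite pair_bigA /= (partition_big (fun ij => (s ij.1)^-1 * t ij.2)%g xpredT) //=.
apply: eq_bigr => g _; rewrite /entry_coef /entry_index.
case: pickP => [ij /eqP Dg|no_ij]; last by rewrite mul0r big_pred0.
by rewrite (big_pred1 ij) ?Dg // => ij' /=; rewrite -Dg (inj_eq st_inj).
Qed.

End Injective.

Definition mx_galg A : group_algebra F gT := [ffun g => entry_coef A g : F^o].

Lemma mx_galg_is_linear : linear mx_galg.
Proof.
move=> c A B; apply/ffunP=> g; rewrite !ffunE /entry_coef.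
by case: (entry_index g) => [ij|]; rewrite ?mxE // scaler0 addr0.
Qed.

HB.instance Definition _ :=
  GRing.isLinear.Build F 'M[F]_(n, m) (group_algebra F gT) _ mx_galg
    mx_galg_is_linear.

End Pair.

Definition galg_mx n p (s : 'I_n -> gT) (u : 'I_p -> gT)
    (a : group_algebra F gT) : 'M[F]_(n, p) :=
  \matrix_(i, k) a ((s i)^-1 * u k)%g.

Lemma galg_mx_is_linear n p (s : 'I_n -> gT) (u : 'I_p -> gT) :
  linear (galg_mx s u).
Proof. by move=> c a b; apply/matrixP=> i k; rewrite !mxE !ffunE. Qed.

HB.instance Definition _ n p (s : 'I_n -> gT) (u : 'I_p -> gT) :=
  GRing.isLinear.Build F (group_algebra F gT) 'M[F]_(n, p) _ (galg_mx s u)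
    (galg_mx_is_linear s u).

Section TripleProduct.

Variables (n m p : nat) (s : 'I_n -> gT) (t : 'I_m -> gT) (u : 'I_p -> gT).
Hypothesis tpp : triple_product s t u.

(** A coincidence of two values is a relation between a quotient of [s] and a quotient of [t]; the
    index [k] supplies the trivial third quotient. *)
Lemma triple_product_inj_left (k : 'I_p) :
  injective (fun ij : 'I_n * 'I_m => (s ij.1)^-1 * t ij.2)%g.
Proof.
move=> [i j] [i' j'] /= /(canRL (mulKVg _)) Dt.
have [|-> -> _] // := @tpp i' i j j' k k.
by rewrite Dt !mulgA !(mulgK, mulgKV) mulgV.
Qed.

Lemma triple_product_inj_right (i : 'I_n) :
  injective (fun jk : 'I_m * 'I_p => (t jk.1)^-1 * u jk.2)%g.
Proof.
move=> [j k] [j' k'] /= /(canRL (mulKVg _)) Du.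
have [|_ -> ->] // := @tpp i i j' j k k'.
by rewrite Du !mulgA !(mulgK, mulgKV) mulgV.
Qed.

(** The argument is what must multiply [(s i)^-1 * t j] on the right to give [(s i')^-1 * u k]. If
    it equals some [(t j')^-1 * u k'], the three quotients multiply to 1, which forces [i = i']. *)
Lemma entry_coef_right (B : 'M[F]_(m, p)) i i' j k :
  entry_coef t u B (((s i)^-1 * t j)^-1 * ((s i')^-1 * u k))%g =
  B j k *+ (i == i').
Proof.
rewrite invMg invgK; have [<-|ne_ii'] := eqVneq i i'.
  rewrite -mulgA mulKVg.
  exact: (entry_coef_val (triple_product_inj_right i) B (j, k)).
rewrite /entry_coef /entry_index; case: pickP => //= -[j' k'] /= /eqP.
move/(canRL (mulKVg _)) => Du; case/eqP: ne_ii'.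
have [|->] // := @tpp i' i j j' k' k.
by rewrite Du !mulgA !(mulgK, mulgKV) mulgV.
Qed.

Lemma galg_mul_entry_coef (A : 'M[F]_(n, m)) (B : 'M[F]_(m, p)) i k :
  galg_mul (mx_galg s t A) (mx_galg t u B) ((s i)^-1 * u k)%g = (A *m B) i k.
Proof.
rewrite galg_mulE.
under eq_bigr do rewrite !ffunE.
rewrite (sum_entry_coef (triple_product_inj_left k)) mxE.
(* Only row [i] of [A] contributes to the coefficient of [(s i)^-1 * u k]. *)
rewrite (bigD1 i) //= [X in _ + X]big1 ?addr0 => [|i' ne_i'i].
  by apply: eq_bigr => j _; rewrite entry_coef_right eqxx.
by apply: big1 => j _; rewrite entry_coef_right (negPf ne_i'i) mulr0.
Qed.

Lemma mxmul_restricts_galg :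
  restricts (mxmul_bilinear F n m p) (galg_bilinear F gT).
Proof.
exists (linfun (mx_galg s t)), (linfun (mx_galg t u)), (linfun (galg_mx s u)).
move=> A B; rewrite !lfunE; apply/matrixP=> i k; rewrite [RHS]mxE.
exact/esym/galg_mul_entry_coef.
Qed.

(** The program counterpart of [mx_galg]: the constant 0 stands for the coefficients off the image
    of the embedding. *)
Definition entry_operand (x : gT + gT) : F + ('I_n * 'I_m + 'I_m * 'I_p) :=
  match x with
  | inl g => if entry_index s t g is Some ij then inr (inl ij) else inl 0
  | inr g => if entry_index t u g is Some jk then inr (inr jk) else inl 0
  end.

Lemma mxmul_coords_subst x (o : 'I_n * 'I_p) :
  galg_mul_coords (subst_input entry_operand x) ((s o.1)^-1 * u o.2)%g =
  mxmul_coords x o.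
Proof.
rewrite /mxmul_coords -galg_mul_entry_coef /galg_mul_coords.
congr (galg_mul _ _ _); apply/ffunP=> g; rewrite !ffunE /subst_input /= /entry_coef;
  by case: (entry_index _ _ g) => [[i j]|] //; rewrite mxE.
Qed.

End TripleProduct.

End Embedding.

Theorem theorem2p3 (F : fieldType) (gT : finGroupType) (n m p : nat)
    (n_gt0 : (0 < n)%N) (m_gt0 : (0 < m)%N) (p_gt0 : (0 < p)%N)
    (Gnmp : realizes gT n m p) :
  (exists k l : nat,
     [/\ is_num_ops (@mxmul_coords F n m p) k,
         is_num_ops (@galg_mul_coords F gT) l & (k <= l)%N]) /\
  restricts (mxmul_bilinear F n m p) (galg_bilinear F gT).
Proof.
have [s [t [u tpp]]] := realizes_triple_product Gnmp.
split; last exact: mxmul_restricts_galg tpp.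
(* Evaluating the defining double sum gives some program, so the minimum [l] exists and is attained
   by a program [P]. *)
have [P0 P0g] := computes_exists (@galg_mul_coords_computable F gT).
have [l l_min _] := num_ops_exists P0g; have [[P Pg DP] _] := l_min.
have Qf := eq_computes (mxmul_coords_subst tpp)
  (computes_subst (entry_operand F s t u)
    (fun o : 'I_n * 'I_p => ((s o.1)^-1 * u o.2)%g) Pg).
(* The renamed [P] multiplies matrices with [l] operations, so the minimum [k] exists and is at most
   [l]. *)
have [k k_min] := num_ops_exists Qf; rewrite cost_subst DP => le_kl.
by exists k, l.
Qed.
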